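(* Let $(c^{n},\bar\mu_c^{n},\bar p^{n},\boldsymbol{u}^{n})_{n\ge 0}$, $\boldsymbol{u}^n=(u^n,v^n)$, be grid functions such that, for every $n\ge 0$, the data at levels $n$ and $n+1$ satisfy the fully discrete primitive scheme (equations (P1)--(P5) of the context), and such that the discrete boundary conditions of the context hold at every level. Write $\rho^n=\rho(c^n)$, $\mu_c^n=\bar\mu_c^n+\alpha\bar p^n$, and define the discrete total energy $$E_h^n=\frac12\big\|\sqrt{\rho^n}\,\boldsymbol u^n\big\|_2^2+\frac{\epsilon\eta}{2We}\big\|\sqrt{\rho^n}\,\boldsymbol\nabla_Dc^n\big\|_2^2+\frac{\eta h^2}{\epsilon We}\big(\rho^nF(c^n),1\big)_2+\frac{h^2}{Fr}\big(\rho^ny,1\big)_2 .$$ Then the scheme is energy stable: for all $n\ge0$, $$E_h^{n+1}-E_h^n=-\frac{\delta t}{Re}\big\|\sqrt{\mu(c^n)}\,\boldsymbol\nabla_d\boldsymbol u^{n+1}\big\|_2^2-\frac{\delta t}{3Re}\big\|\sqrt{\mu(c^n)}\,\boldsymbol\nabla_d\cdot\boldsymbol u^{n+1}\big\|_2^2-\frac{\delta t}{M\,Pe}\big\|\sqrt{m(c^n)}\,\boldsymbol\nabla_D\mu_c^{n+1}\big\|_2^2-\frac12\big\|\sqrt{\rho^n}(\boldsymbol u^{n+1}-\boldsymbol u^n)\big\|_2^2\le0 .$$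
   Context: **Parameters and material functions.** $M,Re,We,Fr,Pe,\eta,\epsilon,\rho_1,\rho_2,\mu_1,\mu_2,\delta t>0$ are constants; $\alpha=(\rho_2-\rho_1)/(\rho_1\rho_2)$; $\rho(c)=\rho_1\rho_2/((\rho_2-\rho_1)c+\rho_1)$; $\mu(c)=\mu_1\mu_2/((\mu_2-\mu_1)c+\mu_1)$ (viscosity); $m(c)=\sqrt{c^2(1-c)^2+\epsilon}$; $F(c)=c^2(c-1)^2/4$; $g(a,b)=\frac14\big(a(a-1)+b(b-1)\big)(a+b-1)$; $r(a,b)=-\alpha\rho(a)\rho(b)$. All values of $c^n$ are such that $(\rho_2-\rho_1)c+\rho_1>0$ and $(\mu_2-\mu_1)c+\mu_1>0$. Superscript $n$ denotes time level $n\delta t$; $\rho^n=\rho(c^n)$, $\rho^{n+\frac12}=\frac12(\rho^{n+1}+\rho^n)$, $c^{n+\frac12}=\frac12(c^{n+1}+c^n)$, $F^{n+\frac12}=\frac12(F(c^{n+1})+F(c^n))$. **Grid.** $\Omega=(0,L_x)\times(0,L_y)$, $L_x=m_1h$, $L_y=m_2h$, $h>0$, $m_1,m_2$ positive integers, $L_x=L_y$. Points: $x_i=(i-\frac12)h$, $x_{i+\frac12}=ih$, $y_j=(j-\frac12)h$, $y_{j+\frac12}=jh$. Cell-centered functions $\phi_{i,j}$ ($c,\bar\mu_c,\mu_c,\bar p$) are indexed by $0\le i\le m_1+1$, $0\le j\le m_2+1$ (indices $0$, $m_1+1$, $m_2+1$ are ghost points); $y$ also denotes the cell-centered function $y_{i,j}=y_j$.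 East-west edge-centered functions $u_{i+\frac12,j}$ live at $(x_{i+\frac12},y_j)$, $0\le i\le m_1$, $0\le j\le m_2+1$; north-south edge-centered functions $v_{i,j+\frac12}$ at $(x_i,y_{j+\frac12})$, $0\le i\le m_1+1$, $0\le j\le m_2$; vertex-centered functions $f_{i+\frac12,j+\frac12}$, $0\le i\le m_1$, $0\le j\le m_2$. Products of grid functions at the same type of points are pointwise. **Operators.** - Edge to center: $a_xu_{i,j}=\frac12(u_{i+\frac12,j}+u_{i-\frac12,j})$, $d_xu_{i,j}=\frac1h(u_{i+\frac12,j}-u_{i-\frac12,j})$, $a_yv_{i,j}=\frac12(v_{i,j+\frac12}+v_{i,j-\frac12})$, $d_yv_{i,j}=\frac1h(v_{i,j+\frac12}-v_{i,j-\frac12})$. - Center to edge: $A_x\phi_{i+\frac12,j}=\frac12(\phi_{i+1,j}+\phi_{i,j})$, $D_x\phi_{i+\frac12,j}=\frac1h(\phi_{i+1,j}-\phi_{i,j})$, $A_y\phi_{i,j+\frac12}=\frac12(\phi_{i,j+1}+\phi_{i,j})$, $D_y\phi_{i,j+\frac12}=\frac1h(\phi_{i,j+1}-\phi_{i,j})$. - Center to vertex: $\mathcal A\phi_{i+\frac12,j+\frac12}=\frac14(\phi_{i+1,j+1}+\phi_{i,j+1}+\phi_{i+1,j}+\phi_{i,j})$. - Edge to vertex: $\mathcal A_xv_{i+\frac12,j+\frac12}=\frac12(v_{i+1,j+\frac12}+v_{i,j+\frac12})$, $\mathcal D_xv_{i+\frac12,j+\frac12}=\frac1h(v_{i+1,j+\frac12}-v_{i,j+\frac12})$,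 $\mathcal A_yu_{i+\frac12,j+\frac12}=\frac12(u_{i+\frac12,j+1}+u_{i+\frac12,j})$, $\mathcal D_yu_{i+\frac12,j+\frac12}=\frac1h(u_{i+\frac12,j+1}-u_{i+\frac12,j})$. - Vertex to edge: $\mathfrak A_xf_{i,j+\frac12}=\frac12(f_{i+\frac12,j+\frac12}+f_{i-\frac12,j+\frac12})$, $\mathfrak D_xf_{i,j+\frac12}=\frac1h(f_{i+\frac12,j+\frac12}-f_{i-\frac12,j+\frac12})$, $\mathfrak A_yf_{i+\frac12,j}=\frac12(f_{i+\frac12,j+\frac12}+f_{i+\frac12,j-\frac12})$, $\mathfrak D_yf_{i+\frac12,j}=\frac1h(f_{i+\frac12,j+\frac12}-f_{i+\frac12,j-\frac12})$. - Special advection terms: $a_x(\rho_{ew}D_xc\,u)_{i,j}=\frac12\big(\rho_{i+1,j}D_xc_{i+\frac12,j}u_{i+\frac12,j}+\rho_{i-1,j}D_xc_{i-\frac12,j}u_{i-\frac12,j}\big)$ and $a_y(\rho_{ns}D_yc\,v)_{i,j}=\frac12\big(\rho_{i,j+1}D_yc_{i,j+\frac12}v_{i,j+\frac12}+\rho_{i,j-1}D_yc_{i,j-\frac12}v_{i,j-\frac12}\big)$. - Special surface tension terms: $A_x(\rho_{ew}\bar\mu_c)_{i+\frac12,j}=\frac12(\rho_{i+1,j}\bar\mu_{c\,i,j}+\rho_{i,j}\bar\mu_{c\,i+1,j})$ and $A_y(\rho_{ns}\bar\mu_c)_{i,j+\frac12}=\frac12(\rho_{i,j+1}\bar\mu_{c\,i,j}+\rho_{i,j}\bar\mu_{c\,i,j+1})$.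 - Cell-centered squared gradient: $|\nabla_Dc|^2=a_x\big((D_xc)^2\big)+a_y\big((D_yc)^2\big)$, and $(|\nabla_Dc|^2)^{n+\frac12}=\frac12\big(|\nabla_Dc^{n+1}|^2+|\nabla_Dc^{n}|^2\big)$. **Inner product and norms.** $(\phi,\psi)_2=\sum_{i=1}^{m_1}\sum_{j=1}^{m_2}\phi_{i,j}\psi_{i,j}$. For vertex-centered $f$ let $\bar f_{i,j}=\frac14(f_{i+\frac12,j+\frac12}+f_{i-\frac12,j+\frac12}+f_{i+\frac12,j-\frac12}+f_{i-\frac12,j-\frac12})$. For cell-centered $\phi\ge0$, $\psi$ and $\boldsymbol u=(u,v)$: $\|\sqrt\phi\,\boldsymbol u\|_2^2=h^2(\phi,a_x(u^2))_2+h^2(\phi,a_y(v^2))_2$; $\|\sqrt\phi\,\boldsymbol\nabla_D\psi\|_2^2=h^2(\phi,a_x((D_x\psi)^2))_2+h^2(\phi,a_y((D_y\psi)^2))_2$; $\|\sqrt\phi\,\boldsymbol\nabla_d\boldsymbol u\|_2^2=h^2(\phi,(d_xu)^2)_2+h^2(\phi,\overline{(\mathcal D_yu)^2})_2+h^2(\phi,\overline{(\mathcal D_xv)^2})_2+h^2(\phi,(d_yv)^2)_2$; $\|\sqrt\phi\,\boldsymbol\nabla_d\cdot\boldsymbol u\|_2^2=h^2(\phi,(d_xu+d_yv)^2)_2$. **Primitive scheme.** (P1) holds at interior east-west edges ($1\le i\le m_1-1$, $1\le j\le m_2$), (P2) at interior north-south edges ($1\le i\le m_1$, $1\le j\le m_2-1$),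 (P3)--(P5) at cells $1\le i\le m_1$, $1\le j\le m_2$. (P1) $A_x\rho^n\frac{u^{n+1}-u^n}{\delta t}+A_x(\rho^na_xu^n\,d_xu^{n+1})+\mathfrak A_y(\mathcal A\rho^n\mathcal A_xv^n\mathcal D_yu^{n+1})+\frac{A_x\rho^{n+1}-A_x\rho^n}{2\delta t}u^{n+1}+\frac12\big(D_x(\rho^na_xu^n)+\mathfrak D_y(\mathcal A\rho^n\mathcal A_xv^n)\big)u^{n+1}=-\frac1MD_x\bar p^{n+1}+\frac1MA_x(\rho^n_{ew}\bar\mu_c^{n+1})D_xc^n+\frac1{Re}\big(D_x(\mu(c^n)d_xu^{n+1})+\mathfrak D_y(\mathcal A\mu(c^n)\mathcal D_yu^{n+1})\big)+\frac1{3Re}D_x\big(\mu(c^n)(d_xu^{n+1}+d_yv^{n+1})\big)$ (P2) $A_y\rho^n\frac{v^{n+1}-v^n}{\delta t}+\mathfrak A_x(\mathcal A\rho^n\mathcal A_yu^n\mathcal D_xv^{n+1})+A_y(\rho^na_yv^n\,d_yv^{n+1})+\frac{A_y\rho^{n+1}-A_y\rho^n}{2\delta t}v^{n+1}+\frac12\big(\mathfrak D_x(\mathcal A\rho^n\mathcal A_yu^n)+D_y(\rho^na_yv^n)\big)v^{n+1}=-\frac1MD_y\bar p^{n+1}+\frac1MA_y(\rho^n_{ns}\bar\mu_c^{n+1})D_yc^n+\frac1{Re}\big(\mathfrak D_x(\mathcal A\mu(c^n)\mathcal D_xv^{n+1})+D_y(\mu(c^n)d_yv^{n+1})\big)+\frac1{3Re}D_y\big(\mu(c^n)(d_xu^{n+1}+d_yv^{n+1})\big)-\frac1{Fr}A_y\rho^n$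 (P3) $d_xu^{n+1}+d_yv^{n+1}=\alpha\,Q^{n+1}$, where $Q^{n+1}=\frac1{Pe}\big[d_x(A_xm(c^n)D_x\bar\mu_c^{n+1})+d_y(A_ym(c^n)D_y\bar\mu_c^{n+1})\big]+\frac{\alpha}{Pe}\big[d_x(A_xm(c^n)D_x\bar p^{n+1})+d_y(A_ym(c^n)D_y\bar p^{n+1})\big]$ (P4) $\rho^{n+1}\frac{c^{n+1}-c^n}{\delta t}+a_x(\rho^n_{ew}D_xc^n\,u^{n+1})+a_y(\rho^n_{ns}D_yc^n\,v^{n+1})=Q^{n+1}$ (P5) $\rho^{n+1}\bar\mu_c^{n+1}=\frac{M\eta}{\epsilon We}\rho^{n+\frac12}g(c^{n+1},c^n)+\frac{M\eta}{\epsilon We}F^{n+\frac12}r(c^{n+1},c^n)+\frac{\epsilon\eta M}{2We}(|\nabla_Dc|^2)^{n+\frac12}r(c^{n+1},c^n)-\frac{\epsilon\eta M}{We}\big[d_x(A_x\rho^{n+\frac12}D_xc^{n+\frac12})+d_y(A_y\rho^{n+\frac12}D_yc^{n+\frac12})\big]$ **Boundary conditions (all levels).** With $\mu_c^n:=\bar\mu_c^n+\alpha\bar p^n$, both $\phi=c^n$ and $\phi=\mu_c^n$ satisfy the discrete Neumann conditions $\phi_{0,j}=\phi_{1,j}$, $\phi_{m_1+1,j}=\phi_{m_1,j}$ ($1\le j\le m_2$), $\phi_{i,0}=\phi_{i,1}$, $\phi_{i,m_2+1}=\phi_{i,m_2}$ ($1\le i\le m_1$). The velocity satisfies no-slip: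 $u_{\frac12,j}=u_{m_1+\frac12,j}=0$ ($1\le j\le m_2$), $\frac12(u_{i+\frac12,0}+u_{i+\frac12,1})=\frac12(u_{i+\frac12,m_2}+u_{i+\frac12,m_2+1})=0$ ($0\le i\le m_1$), $v_{i,\frac12}=v_{i,m_2+\frac12}=0$ ($1\le i\le m_1$), $\frac12(v_{0,j+\frac12}+v_{1,j+\frac12})=\frac12(v_{m_1,j+\frac12}+v_{m_1+1,j+\frac12})=0$ ($0\le j\le m_2$). *)

(* Defs.v *)
From HB Require Import structures.
From mathcomp Require Import all_boot all_order all_algebra.
From mathcomp Require Import reals.

Set Implicit Arguments.
Unset Strict Implicit.
Unset Printing Implicit Defensive.

Import Order.TTheory GRing.Theory Num.Theory.
Local Open Scope ring_scope.

(* All grid functions on the staggered grid are represented by functions of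
   two natural-number indices; a half-integer index k + 1/2 is stored as k:
     cell centers       phi i j = phi_(i, j)
     east-west edges    u i j   = u_(i+1/2, j)
     north-south edges  v i j   = v_(i, j+1/2)
     vertices           f i j   = f_(i+1/2, j+1/2)
   so that an index k - 1/2 (with k >= 1) is stored as k.-1.  Values outside
   of the index ranges of the grid are never constrained nor used. *)
Definition cellfun (R : realType) := nat -> nat -> R.
Definition ewfun (R : realType) := nat -> nat -> R.
Definition nsfun (R : realType) := nat -> nat -> R.
Definition vertfun (R : realType) := nat -> nat -> R.

Definition gmul (R : realType) (f g : nat -> nat -> R) : nat -> nat -> R :=
  fun i j => f i j * g i j.
Notation "f \** g" := (gmul f g) (at level 40, left associativity) : ring_scope.
Definition gsqr (R : realType) (f : nat -> nat -> R) := f \** f.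
Definition gadd (R : realType) (f g : nat -> nat -> R) : nat -> nat -> R :=
  fun i j => f i j + g i j.
Definition gsub (R : realType) (f g : nat -> nat -> R) : nat -> nat -> R :=
  fun i j => f i j - g i j.
Definition gavg (R : realType) (f g : nat -> nat -> R) : nat -> nat -> R :=
  fun i j => (f i j + g i j) / 2.
Definition gmap (R : realType) (k : R -> R) (phi : cellfun R) : cellfun R :=
  fun i j => k (phi i j).

Record params (R : realType) := Params {
  pM : R; pRe : R; pWe : R; pFr : R; pPe : R; peta : R; peps : R;
  prho1 : R; prho2 : R; pmu1 : R; pmu2 : R; pdt : R
}.

Definition params_pos (R : realType) (P : params R) : Prop :=
  [/\ [/\ 0 < pM P, 0 < pRe P, 0 < pWe P & 0 < pFr P],
      [/\ 0 < pPe P, 0 < peta P, 0 < peps P & 0 < pdt P] &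
      [/\ 0 < prho1 P, 0 < prho2 P, 0 < pmu1 P & 0 < pmu2 P]].

Record grid (R : realType) := Grid {
  gLx : R; gLy : R; gh : R; gm1 : nat; gm2 : nat
}.

Definition grid_ok (R : realType) (G : grid R) : Prop :=
  [/\ 0 < gh G, (0 < gm1 G)%N && (0 < gm2 G)%N,
      gLx G = (gm1 G)%:R * gh G, gLy G = (gm2 G)%:R * gh G & gLx G = gLy G].

Section Material.
Context (R : realType) (P : params R).

Definition alpha : R := (prho2 P - prho1 P) / (prho1 P * prho2 P).
Definition rho (c : R) : R :=
  prho1 P * prho2 P / ((prho2 P - prho1 P) * c + prho1 P).
Definition visc (c : R) : R :=
  pmu1 P * pmu2 P / ((pmu2 P - pmu1 P) * c + pmu1 P).
Definition mob (c : R) : R := Num.sqrt (c ^+ 2 * (1 - c) ^+ 2 + peps P).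
Definition Fdw (c : R) : R := c ^+ 2 * (c - 1) ^+ 2 / 4.
Definition gfun (a b : R) : R :=
  (a * (a - 1) + b * (b - 1)) * (a + b - 1) / 4.
Definition rfun (a b : R) : R := - alpha * rho a * rho b.

End Material.

Section Operators.
Context (R : realType) (G : grid R).
Local Notation h := (gh G).
Local Notation m1 := (gm1 G).
Local Notation m2 := (gm2 G).

Definition ax (u : ewfun R) : cellfun R := fun i j => (u i j + u i.-1 j) / 2.
Definition dx (u : ewfun R) : cellfun R := fun i j => (u i j - u i.-1 j) / h.
Definition ay (v : nsfun R) : cellfun R := fun i j => (v i j + v i j.-1) / 2.
Definition dy (v : nsfun R) : cellfun R := fun i j => (v i j - v i j.-1) / h.

Definition Ax (phi : cellfun R) : ewfun R :=
  fun i j => (phi i.+1 j + phi i j) / 2.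
Definition Dx (phi : cellfun R) : ewfun R :=
  fun i j => (phi i.+1 j - phi i j) / h.
Definition Ay (phi : cellfun R) : nsfun R :=
  fun i j => (phi i j.+1 + phi i j) / 2.
Definition Dy (phi : cellfun R) : nsfun R :=
  fun i j => (phi i j.+1 - phi i j) / h.

Definition Avert (phi : cellfun R) : vertfun R :=
  fun i j => (phi i.+1 j.+1 + phi i j.+1 + phi i.+1 j + phi i j) / 4.

(* edge to vertex: the calligraphic A_x, D_x (on north-south edges) and
   A_y, D_y (on east-west edges) *)
Definition cAx (v : nsfun R) : vertfun R := fun i j => (v i.+1 j + v i j) / 2.
Definition cDx (v : nsfun R) : vertfun R := fun i j => (v i.+1 j - v i j) / h.
Definition cAy (u : ewfun R) : vertfun R := fun i j => (u i j.+1 + u i j) / 2.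
Definition cDy (u : ewfun R) : vertfun R := fun i j => (u i j.+1 - u i j) / h.

(* vertex to edge: the fraktur A_x, D_x (to north-south edges) and
   A_y, D_y (to east-west edges) *)
Definition fAx (f : vertfun R) : nsfun R := fun i j => (f i j + f i.-1 j) / 2.
Definition fDx (f : vertfun R) : nsfun R := fun i j => (f i j - f i.-1 j) / h.
Definition fAy (f : vertfun R) : ewfun R := fun i j => (f i j + f i j.-1) / 2.
Definition fDy (f : vertfun R) : ewfun R := fun i j => (f i j - f i j.-1) / h.

(* a_x(rho_ew D_x c u) and a_y(rho_ns D_y c v) *)
Definition advx (rh c : cellfun R) (u : ewfun R) : cellfun R := fun i j =>
  (rh i.+1 j * Dx c i j * u i j + rh i.-1 j * Dx c i.-1 j * u i.-1 j) / 2.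
Definition advy (rh c : cellfun R) (v : nsfun R) : cellfun R := fun i j =>
  (rh i j.+1 * Dy c i j * v i j + rh i j.-1 * Dy c i j.-1 * v i j.-1) / 2.

(* A_x(rho_ew mu) and A_y(rho_ns mu) *)
Definition stx (rh mb : cellfun R) : ewfun R := fun i j =>
  (rh i.+1 j * mb i j + rh i j * mb i.+1 j) / 2.
Definition sty (rh mb : cellfun R) : nsfun R := fun i j =>
  (rh i j.+1 * mb i j + rh i j * mb i j.+1) / 2.

Definition ddiv (u : ewfun R) (v : nsfun R) : cellfun R := gadd (dx u) (dy v).

(* d_x(A_x w D_x phi) + d_y(A_y w D_y phi) *)
Definition divgrad (w phi : cellfun R) : cellfun R :=
  ddiv (Ax w \** Dx phi) (Ay w \** Dy phi).

Definition grad2 (c : cellfun R) : cellfun R :=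
  gadd (ax (gsqr (Dx c))) (ay (gsqr (Dy c))).

Definition vbar (f : vertfun R) : cellfun R := fun i j =>
  (f i j + f i.-1 j + f i j.-1 + f i.-1 j.-1) / 4.

Definition ip (phi psi : cellfun R) : R :=
  \sum_(1 <= i < m1.+1) \sum_(1 <= j < m2.+1) phi i j * psi i j.

Definition ycell : cellfun R := fun _ j => (j%:R - 2^-1) * h.

(* Squared weighted norms; the first argument is phi, not sqrt phi:
   || sqrt phi u ||^2, || sqrt phi grad_D psi ||^2,
   || sqrt phi grad_d u ||^2, || sqrt phi div_d u ||^2. *)
Definition nrm2_vel (phi : cellfun R) (u : ewfun R) (v : nsfun R) : R :=
  h ^+ 2 * ip phi (ax (gsqr u)) + h ^+ 2 * ip phi (ay (gsqr v)).
Definition nrm2_grad (phi psi : cellfun R) : R :=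
  h ^+ 2 * ip phi (ax (gsqr (Dx psi))) + h ^+ 2 * ip phi (ay (gsqr (Dy psi))).
Definition nrm2_gradvel (phi : cellfun R) (u : ewfun R) (v : nsfun R) : R :=
  h ^+ 2 * ip phi (gsqr (dx u)) + h ^+ 2 * ip phi (vbar (gsqr (cDy u)))
  + h ^+ 2 * ip phi (vbar (gsqr (cDx v))) + h ^+ 2 * ip phi (gsqr (dy v)).
Definition nrm2_div (phi : cellfun R) (u : ewfun R) (v : nsfun R) : R :=
  h ^+ 2 * ip phi (gsqr (ddiv u v)).

Definition neumann (phi : cellfun R) : Prop :=
  (forall j, (1 <= j <= m2)%N ->
     phi 0%N j = phi 1%N j /\ phi m1.+1 j = phi m1 j) /\
  (forall i, (1 <= i <= m1)%N ->
     phi i 0%N = phi i 1%N /\ phi i m2.+1 = phi i m2).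

Definition no_slip (u : ewfun R) (v : nsfun R) : Prop :=
  [/\ forall j, (1 <= j <= m2)%N -> u 0%N j = 0 /\ u m1 j = 0,
      forall i, (i <= m1)%N ->
        (u i 0%N + u i 1%N) / 2 = 0 /\ (u i m2 + u i m2.+1) / 2 = 0,
      forall i, (1 <= i <= m1)%N -> v i 0%N = 0 /\ v i m2 = 0 &
      forall j, (j <= m2)%N ->
        (v 0%N j + v 1%N j) / 2 = 0 /\ (v m1 j + v m1.+1 j) / 2 = 0].

End Operators.

(* The unknowns at one time level; smub is bar mu_c and spb is bar p. *)
Record state (R : realType) := State {
  sc : cellfun R; smub : cellfun R; spb : cellfun R;
  su : ewfun R; sv : nsfun R
}.

Section Scheme.
Context (R : realType) (P : params R) (G : grid R).
Local Notation h := (gh G).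
Local Notation m1 := (gm1 G).
Local Notation m2 := (gm2 G).
Local Notation M := (pM P).
Local Notation Re := (pRe P).
Local Notation We := (pWe P).
Local Notation Fr := (pFr P).
Local Notation Pe := (pPe P).
Local Notation eta := (peta P).
Local Notation eps := (peps P).
Local Notation dt := (pdt P).
Local Notation ax := (@ax R).
Local Notation ay := (@ay R).
Local Notation dx := (dx G).
Local Notation dy := (dy G).
Local Notation Dx := (Dx G).
Local Notation Dy := (Dy G).
Local Notation cDx := (cDx G).
Local Notation cDy := (cDy G).
Local Notation fDx := (fDx G).
Local Notation fDy := (fDy G).
Local Notation ddiv := (ddiv G).
Local Notation divgrad := (divgrad G).

Definition srho (s : state R) : cellfun R := gmap (rho P) (sc s).
Definition svisc (s : state R) : cellfun R := gmap (visc P) (sc s).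
Definition smob (s : state R) : cellfun R := gmap (mob P) (sc s).
Definition sF (s : state R) : cellfun R := gmap (@Fdw R) (sc s).

(* mu_c, as opposed to smub, which is bar mu_c *)
Definition smu (s : state R) : cellfun R :=
  fun i j => smub s i j + alpha P * spb s i j.

Definition admissible (s : state R) : Prop :=
  forall i j, (i <= m1.+1)%N -> (j <= m2.+1)%N ->
    0 < (prho2 P - prho1 P) * sc s i j + prho1 P /\
    0 < (pmu2 P - pmu1 P) * sc s i j + pmu1 P.

Definition boundary_conditions (s : state R) : Prop :=
  [/\ neumann G (sc s), neumann G (smu s) & no_slip G (su s) (sv s)].

(* Below, s is the state at level n and s' the state at level n + 1. *)

Definition Qflux (s s' : state R) : cellfun R := fun i j =>
  1 / Pe * divgrad (smob s) (smub s') i j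
  + alpha P / Pe * divgrad (smob s) (spb s') i j.

Definition eq_momentum_x (s s' : state R) (i j : nat) : Prop :=
  let u := su s in let v := sv s in
  let u' := su s' in let v' := sv s' in
  let rh := srho s in let rh' := srho s' in let mu := svisc s in
  Ax rh i j * ((u' i j - u i j) / dt)
  + Ax (rh \** ax u \** dx u') i j
  + fAy (Avert rh \** cAx v \** cDy u') i j
  + (Ax rh' i j - Ax rh i j) / (2 * dt) * u' i j
  + 1 / 2 * (Dx (rh \** ax u) i j + fDy (Avert rh \** cAx v) i j) * u' i j
  = - (1 / M * Dx (spb s') i j)
    + 1 / M * stx rh (smub s') i j * Dx (sc s) i j
    + 1 / Re * (Dx (mu \** dx u') i j + fDy (Avert mu \** cDy u') i j)
    + 1 / (3 * Re) * Dx (mu \** ddiv u' v') i j.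

Definition eq_momentum_y (s s' : state R) (i j : nat) : Prop :=
  let u := su s in let v := sv s in
  let u' := su s' in let v' := sv s' in
  let rh := srho s in let rh' := srho s' in let mu := svisc s in
  Ay rh i j * ((v' i j - v i j) / dt)
  + fAx (Avert rh \** cAy u \** cDx v') i j
  + Ay (rh \** ay v \** dy v') i j
  + (Ay rh' i j - Ay rh i j) / (2 * dt) * v' i j
  + 1 / 2 * (fDx (Avert rh \** cAy u) i j + Dy (rh \** ay v) i j) * v' i j
  = - (1 / M * Dy (spb s') i j)
    + 1 / M * sty rh (smub s') i j * Dy (sc s) i j
    + 1 / Re * (fDx (Avert mu \** cDx v') i j + Dy (mu \** dy v') i j)
    + 1 / (3 * Re) * Dy (mu \** ddiv u' v') i j
    - 1 / Fr * Ay rh i j.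

Definition eq_quasi_incompressible (s s' : state R) (i j : nat) : Prop :=
  dx (su s') i j + dy (sv s') i j = alpha P * Qflux s s' i j.

Definition eq_phase (s s' : state R) (i j : nat) : Prop :=
  srho s' i j * ((sc s' i j - sc s i j) / dt)
  + advx G (srho s) (sc s) (su s') i j + advy G (srho s) (sc s) (sv s') i j
  = Qflux s s' i j.

Definition eq_chemical_potential (s s' : state R) (i j : nat) : Prop :=
  let rhalf := gavg (srho s') (srho s) in
  let c' := sc s' i j in let c := sc s i j in
  srho s' i j * smub s' i j
  = M * eta / (eps * We) * rhalf i j * gfun c' c
    + M * eta / (eps * We) * gavg (sF s') (sF s) i j * rfun P c' c
    + eps * eta * M / (2 * We)
      * gavg (grad2 G (sc s')) (grad2 G (sc s)) i j * rfun P c' c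
    - eps * eta * M / We * divgrad rhalf (gavg (sc s') (sc s)) i j.

Definition scheme_step (s s' : state R) : Prop :=
  [/\ forall i j, (1 <= i < m1)%N -> (1 <= j <= m2)%N -> eq_momentum_x s s' i j,
      forall i j, (1 <= i <= m1)%N -> (1 <= j < m2)%N -> eq_momentum_y s s' i j,
      forall i j, (1 <= i <= m1)%N -> (1 <= j <= m2)%N ->
        eq_quasi_incompressible s s' i j,
      forall i j, (1 <= i <= m1)%N -> (1 <= j <= m2)%N -> eq_phase s s' i j &
      forall i j, (1 <= i <= m1)%N -> (1 <= j <= m2)%N ->
        eq_chemical_potential s s' i j].

Definition energy (s : state R) : R :=
  1 / 2 * nrm2_vel G (srho s) (su s) (sv s)
  + eps * eta / (2 * We) * nrm2_grad G (srho s) (sc s)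
  + eta * h ^+ 2 / (eps * We) * ip G (srho s \** sF s) (fun _ _ => 1)
  + h ^+ 2 / Fr * ip G (srho s \** ycell G) (fun _ _ => 1).

End Scheme.

(* Main.v *)
Require Import Defs.
From HB Require Import structures.
From mathcomp Require Import all_boot all_order all_algebra.
From mathcomp Require Import reals ring lra.

(** The energy law is the discrete counterpart of testing the momentum equation
    with the new velocity, the quasi-incompressibility constraint with the
    pressure, the phase equation with the chemical potential and the equation
    of the chemical potential with the increment of c.  The averages of the
    scheme are chosen such that each of these tests is exact, and all of them
    reduce to one principle: two cell functions whose difference is the
    divergence of a flux that vanishes at the walls have the same sum over the
    cells ([cellsum_divergence]).  Every summation by parts below consists in
    exhibiting such a flux; what remains is a pointwise rational identity.  The
    velocity vanishes on the walls, so the momentum equation, known on interior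
    edges only, becomes true on all edges with a cell on their left once it is
    multiplied by the velocity, and sums over edges are sums over cells.

    Testing the momentum equation ([momentum_balance]) turns inertia into the
    change of kinetic energy plus the numerical dissipation
    |u^(n+1) - u^n|^2 / 2, cancels convection because it is written in skew form
    ([sum_convection]), and turns the stresses into viscous dissipation.  Its
    right-hand side keeps three works.  Pressure and surface tension
    ([pressure_work], [surface_tension_work]) add up to the product of the flux
    Q with mu_c, i.e. to the opposite of the mobility dissipation
    ([mobility_dissipation]), minus the sum of
    mu_c-bar rho^(n+1) (c^(n+1) - c^n) / dt.  Up to constants the latter is the
    rate of change of the free energy ([free_energy_jump]), because g and r are
    exact difference quotients of F and rho ([Fdw_jump], [rho_jump]).  The same
    property of r turns the phase equation into conservation of mass
    ([mass_conservation]), by which the work of gravity is the change of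
    potential energy ([gravity_work]).

    The second momentum equation is the first one with the two axes exchanged
    and a force added; [flip] and [flip_grid] make the exchange. *)

Set Implicit Arguments.
Unset Strict Implicit.
Unset Printing Implicit Defensive.

Import Order.TTheory GRing.Theory Num.Theory.
Local Open Scope ring_scope.

(** * Sums over the cells *)

(** Iterated, this reduces a goal that is a linear combination of known
    equations, with parameters of the scheme as coefficients, to an identity of
    rational functions. *)
Lemma eq_by_combination (R : realType) (k a b x y : R) :
  a = b -> x - k * a = y - k * b -> x = y.
Proof. by move=> -> /addIr. Qed.

Section CellSum.
Context (R : realType) (G : grid R).
Local Notation m1 := (gm1 G).
Local Notation m2 := (gm2 G).

Definition cellsum (f : cellfun R) : R :=
  \sum_(1 <= i < m1.+1) \sum_(1 <= j < m2.+1) f i j.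

Lemma ipE f g : ip G f g = cellsum (f \** g). Proof. by []. Qed.

Lemma cellsumE f : cellsum f = \sum_(i < m1) \sum_(j < m2) f i.+1 j.+1.
Proof.
rewrite /cellsum big_add1 big_mkord; apply: eq_bigr => i _.
by rewrite big_add1 big_mkord.
Qed.

Lemma cellsumD f g : cellsum (gadd f g) = cellsum f + cellsum g.
Proof.
by rewrite /cellsum -big_split /=; apply: eq_bigr => i _; rewrite -big_split.
Qed.

Lemma cellsumZ a f : cellsum (fun i j => a * f i j) = a * cellsum f.
Proof.
by rewrite /cellsum mulr_sumr; apply: eq_bigr => i _; rewrite mulr_sumr.
Qed.

Lemma cellsum_eq (f g : cellfun R) :
  (forall i j, (i < m1)%N -> (j < m2)%N -> f i.+1 j.+1 = g i.+1 j.+1) ->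
  cellsum f = cellsum g.
Proof.
by move=> fg; rewrite !cellsumE; apply: eq_bigr => i _; apply: eq_bigr => j _;
  apply: fg.
Qed.

Lemma cellsum_ge0 (f : cellfun R) :
  (forall i j, (i < m1)%N -> (j < m2)%N -> 0 <= f i.+1 j.+1) -> 0 <= cellsum f.
Proof.
by move=> f0; rewrite cellsumE; apply: sumr_ge0 => i _; apply: sumr_ge0 => j _;
  apply: f0.
Qed.

Lemma sum_telescope (T : nat -> R) m :
  \sum_(i < m) (T i.+1 - T i) = T m - T 0%N.
Proof. by rewrite -(big_mkord xpredT (fun i => T i.+1 - T i)) telescope_sumr. Qed.

(** The discrete divergence theorem.  The flux T1 is read on the edges i = 0 and
    i = m1 along interior rows only, and T2 likewise along interior columns, so
    that corner values never enter. *)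
Lemma cellsum_divergence (T1 : ewfun R) (T2 : nsfun R) (f g : cellfun R) :
  (forall j, (j < m2)%N -> T1 m1 j.+1 = 0 /\ T1 0%N j.+1 = 0) ->
  (forall i, (i < m1)%N -> T2 i.+1 m2 = 0 /\ T2 i.+1 0%N = 0) ->
  (forall i j, (i < m1)%N -> (j < m2)%N ->
     f i.+1 j.+1 = g i.+1 j.+1 + (T1 i.+1 j.+1 - T1 i j.+1)
                   + (T2 i.+1 j.+1 - T2 i.+1 j)) ->
  cellsum f = cellsum g.
Proof.
move=> T1b T2b fg; rewrite !cellsumE.
have -> : \sum_(i < m1) \sum_(j < m2) f i.+1 j.+1 =
    \sum_(i < m1) \sum_(j < m2) g i.+1 j.+1
    + \sum_(j < m2) \sum_(i < m1) (T1 i.+1 j.+1 - T1 i j.+1)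
    + \sum_(i < m1) \sum_(j < m2) (T2 i.+1 j.+1 - T2 i.+1 j).
  rewrite [X in _ + X + _]exchange_big -!big_split; apply: eq_bigr => i _.
  by rewrite -!big_split; apply: eq_bigr => j _; apply: fg.
rewrite [X in _ + X + _]big1 => [|j _]; last first.
  rewrite (sum_telescope (fun i => T1 i j.+1)).
  by have [-> ->] := T1b j (ltn_ord j); rewrite subrr.
rewrite [X in _ + _ + X]big1 => [|i _]; last first.
  rewrite (sum_telescope (fun j => T2 i.+1 j)).
  by have [-> ->] := T2b i (ltn_ord i); rewrite subrr.
by rewrite !addr0.
Qed.

End CellSum.

(** * Exchange of the axes *)

(** The operators in y on f are convertible to the operators in x on [flip f],
    which identifies most terms of the two momentum equations without proof;
    for [Avert] and [vbar] the exchange permutes summands. *)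
Definition flip (R : realType) (f : nat -> nat -> R) : nat -> nat -> R :=
  fun i j => f j i.

Definition flip_grid (R : realType) (G : grid R) : grid R :=
  Grid (gLy G) (gLx G) (gh G) (gm2 G) (gm1 G).

Lemma cellsum_flip (R : realType) (G : grid R) (f : cellfun R) :
  cellsum (flip_grid G) (flip f) = cellsum G f.
Proof. by rewrite /cellsum exchange_big. Qed.

(** * Summation by parts between edges and cells *)

Section Fluxes.
Context (R : realType) (G : grid R).
Local Notation h := (gh G).
Local Notation m1 := (gm1 G).
Local Notation m2 := (gm2 G).
Local Notation cellsum := (cellsum G).
Context (h0 : h != 0).

Definition no_flux (u : ewfun R) : Prop :=
  forall j, (j < m2)%N -> u m1 j.+1 = 0 /\ u 0%N j.+1 = 0.

(** The form of the divergence theorem for a flux proportional to a quantity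
    without flux through the walls. *)
Lemma cellsum_flux (q u : ewfun R) (f g : cellfun R) : no_flux u ->
  (forall i j, (i < m1)%N -> (j < m2)%N ->
     f i.+1 j.+1 = g i.+1 j.+1
                   + (q i.+1 j.+1 * u i.+1 j.+1 - q i j.+1 * u i j.+1)) ->
  cellsum f = cellsum g.
Proof.
move=> ub fg; apply: (@cellsum_divergence _ _ (q \** u) (fun _ _ => 0)) => //.
  by move=> j jm; have [e e'] := ub j jm; rewrite /gmul e e' !mulr0.
by move=> i j im jm; rewrite fg // subrr addr0.
Qed.

(** Since u is zero on the last edge, the left-hand side is the sum over the
    interior edges, although it is written as a sum over cells. *)
Lemma sum_by_parts (q : cellfun R) (u : ewfun R) : no_flux u ->
  cellsum (Dx G q \** u) = - cellsum (q \** dx G u).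
Proof.
move=> ub; rewrite -mulN1r -cellsumZ.
apply: (cellsum_flux (q := fun i j => q i.+1 j / h) ub) => i j _ _.
by rewrite /gmul /Dx /dx /=; field.
Qed.

Lemma sum_edge_average (q : cellfun R) (u : ewfun R) : no_flux u ->
  cellsum (Ax q \** u) = cellsum (q \** ax u).
Proof.
move=> ub.
apply: (cellsum_flux (q := fun i j => q i.+1 j / 2) ub) => i j _ _.
by rewrite /gmul /ax /Ax /=; field.
Qed.

(** This duality dictates the crossed products of density and potential in the
    surface tension: collecting the terms with u at one edge from its two
    adjacent cells pairs the potential of each cell with the density of the
    other. *)
Lemma sum_surface_tension (rh mb c : cellfun R) (u : ewfun R) : no_flux u ->
  cellsum (stx rh mb \** Dx G c \** u) = cellsum (mb \** advx G rh c u).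
Proof.
move=> ub.
apply: (cellsum_flux
  (q := fun i j => rh i j * mb i.+1 j * Dx G c i j / 2) ub) => i j _ _.
by rewrite /gmul /stx /advx /Dx /=; field.
Qed.

Lemma neumann_no_flux phi : neumann G phi -> no_flux (Dx G phi).
Proof.
move=> [bx _] j jm; have [e e'] := bx j.+1 jm.
by rewrite /Dx e e' !subrr mul0r.
Qed.

(** On both sides the weight of the edge product Dx phi Dx psi is the average of
    w over the two adjacent cells; at the walls Dx phi vanishes. *)
Lemma green_x (w phi psi : cellfun R) : no_flux (Dx G phi) ->
  cellsum (psi \** dx G (Ax w \** Dx G phi))
  = - cellsum (w \** ax (Dx G phi \** Dx G psi)).
Proof.
move=> ub; rewrite -mulN1r -cellsumZ.
apply: (cellsum_flux (q := fun i j =>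
  psi i j * Ax w i j / h + w i j * Dx G psi i j / 2) ub) => i j _ _.
by rewrite /gmul /Ax /Dx /ax /dx /=; field.
Qed.

End Fluxes.

(** * Balance of one momentum component *)

Section Momentum.
Context (R : realType) (G : grid R).
Local Notation h := (gh G).
Local Notation m1 := (gm1 G).
Local Notation m2 := (gm2 G).
Local Notation cellsum := (cellsum G).
Context (h0 : h != 0).

(** The no-slip conditions for the first component, extended to the rows of
    ghost points: vertex differences of u along a wall involve u there. *)
Definition wall (u : ewfun R) : Prop :=
  (forall j, (j <= m2.+1)%N -> u m1 j = 0 /\ u 0%N j = 0) /\
  (forall i, (i <= m1)%N -> u i 0%N = - u i 1%N /\ u i m2.+1 = - u i m2).

(** A corner ghost value vanishes because the tangential condition makes it the
    opposite of a value at a wall. *)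
Lemma no_slip_wall (u : ewfun R) : (0 < m2)%N ->
  (forall j, (0 < j <= m2)%N -> u 0%N j = 0 /\ u m1 j = 0) ->
  (forall i, (i <= m1)%N ->
     (u i 0%N + u i 1%N) / 2 = 0 /\ (u i m2 + u i m2.+1) / 2 = 0) ->
  wall u.
Proof.
move=> m2p ux uy.
have half0 (a b : R) : (a + b) / 2 = 0 -> a = - b by lra.
have uy' i : (i <= m1)%N -> u i 0%N = - u i 1%N /\ u i m2.+1 = - u i m2.
  by move=> /uy[/half0 -> ]; rewrite addrC => /half0 ->.
split=> // j; rewrite leq_eqVlt => /predU1P[->|].
  rewrite (proj2 (uy' _ (leqnn _))) (proj2 (uy' 0%N (leq0n _))).
  by have [|-> ->] := ux m2; rewrite ?leqnn ?m2p ?oppr0.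
case: j => [_|j jm]; last by have [//|-> ->] := ux j.+1.
rewrite (proj1 (uy' _ (leqnn _))) (proj1 (uy' 0%N (leq0n _))).
by have [|-> ->] := ux 1%N; rewrite ?m2p ?oppr0.
Qed.

Lemma wall_no_flux u : wall u -> no_flux G u.
Proof. by move=> [ub _] j jm; apply: ub; rewrite ltnS ltnW. Qed.

Lemma wall_no_fluxM u v : wall u -> no_flux G (v \** u).
Proof.
by move=> /wall_no_flux ub j /ub[e e']; rewrite /gmul e e' !mulr0.
Qed.

(** Convection plus half of u times the divergence of the mass flux is skew: in
    each direction it reduces to (w_+ u_+ - w_- u_-) / (2 h), with u_+ and u_-
    at the neighbouring edges and the mass fluxes w_+ and w_- half a cell away,
    and the product of this with u telescopes. *)
Lemma sum_convection (w : cellfun R) (W : vertfun R) (u : ewfun R) :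
  wall u ->
  (forall i, (0 < i < m1)%N -> W i m2 = 0 /\ W i 0%N = 0) ->
  cellsum (fun i j =>
    (Ax (w \** dx G u) i j + fAy (W \** cDy G u) i j
     + 1 / 2 * (Dx G w i j + fDy G W i j) * u i j) * u i j) = 0.
Proof.
move=> [ub _] Wb; rewrite -[RHS](mul0r (cellsum (fun _ _ => 0))) -cellsumZ.
apply: (cellsum_divergence
  (T1 := fun i j => w i.+1 j * u i.+1 j / (2 * h) * u i j)
  (T2 := fun i j => W i j * u i j * u i j.+1 / (2 * h))).
- move=> j jm; have [|-> ->] := ub j.+1; first by rewrite ltnS ltnW.
  by rewrite !mulr0.
- (* In the last column u, not W, is what vanishes. *)
  move=> i; rewrite leq_eqVlt => /predU1P[->|i1].
    have [//|-> _] := ub m2; have [//|-> _] := ub 0%N.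
    by rewrite !(mulr0, mul0r).
  by have [//|-> ->] := Wb i.+1; rewrite !mul0r.
- by move=> i j _ _; rewrite /gmul /Ax /fAy /fDy /cDy /Dx /dx /=; field.
Qed.

(** Along a horizontal wall, u is antisymmetric and mu symmetric about the wall.
    Hence the flux mu u Dy u, whose natural value at the wall contains the
    average of u, is zero there, and each wall vertex receives half of the
    weight of an interior one.  This is the weight that [vbar] gives it, as a
    wall vertex has only half as many interior cells around it. *)
Lemma sum_shear (mu : cellfun R) (u : ewfun R) :
  wall u ->
  (forall i, (0 < i <= m1)%N -> mu i 0%N = mu i 1%N /\ mu i m2.+1 = mu i m2) ->
  cellsum (fDy G (Avert mu \** cDy G u) \** u)
  = - cellsum (mu \** vbar (gsqr (cDy G u))).
Proof.
move=> [ux uy] mub; rewrite -mulN1r -cellsumZ.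
(* T1 gathers at the vertices the cell average of the squared differences.  The
   first term of T2 is the flux mu u Dy u; the second one corrects for the use
   of Avert mu, instead of the value of mu in one row, at the vertex. *)
apply: (cellsum_divergence
  (T1 := fun i j =>
     - (mu i.+1 j * (gsqr (cDy G u) i j + gsqr (cDy G u) i j.-1) / 4))
  (T2 := fun i j =>
     Avert mu i j * (u i j.+1 - u i j) * (u i j.+1 + u i j) / (2 * h ^+ 2)
     + (Ax mu i j - Ax mu i j.+1) * (u i j.+1 - u i j) ^+ 2 / (4 * h ^+ 2))).
- move=> j jm; rewrite /gsqr /gmul /cDy /=.
  have jm' : (j <= m2.+1)%N by rewrite ltnW // ltnS ltnW.
  have [|-> ->] := ux j.+2; first by rewrite ltnS.
  have [|-> ->] := ux j.+1; first by rewrite ltnS ltnW.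
  by have [//|-> ->] := ux j; split; field.
- move=> i im.
  have [e0 em] := uy i.+1 im; rewrite e0 em.
  have [i1|i1] := eqVneq i.+1 m1.
    rewrite i1; have [//|-> _] := ux m2; have [//|-> _] := ux 1%N.
    by split; field.
  have i2 : (0 < i.+2 <= m1)%N by rewrite /= ltn_neqAle i1.
  rewrite /Ax; have [//|-> ->] := mub i.+1; have [//|-> ->] := mub i.+2.
  by split; field.
- move=> i j _ _.
  by rewrite /gsqr /gmul /vbar /Ax /Avert /fDy /cDy /=; field.
Qed.

(** Inertia combines with the term for the variation of the density through
    2 rho (u' - u) u' + (rho' - rho) u'^2
    = rho' u'^2 - rho u^2 + rho (u' - u)^2. *)
Lemma sum_kinetic (dt : R) (rh rh' : cellfun R) (u u' : ewfun R) :
  dt != 0 -> wall u -> wall u' ->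
  cellsum (fun i j =>
    (Ax rh i j * ((u' i j - u i j) / dt)
     + (Ax rh' i j - Ax rh i j) / (2 * dt) * u' i j) * u' i j)
  = (2 * dt)^-1 * (cellsum (rh' \** ax (gsqr u')) - cellsum (rh \** ax (gsqr u))
      + cellsum (rh \** ax (gsqr (gsub u' u)))).
Proof.
move=> dt0 ub ub'.
have ubb : wall (gsub u' u).
  case: ub ub' => [ux uy] [ux' uy']; split=> [j jm|i im]; rewrite /gsub.
    by have [-> ->] := ux j jm; have [-> ->] := ux' j jm; rewrite subrr.
  have [-> ->] := uy i im; have [-> ->] := uy' i im.
  by rewrite !opprD.
rewrite -!sum_edge_average; do ?exact: wall_no_fluxM.
rewrite -mulN1r -!cellsumZ -!cellsumD -cellsumZ; apply: cellsum_eq => i j _ _.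
by rewrite /gadd /gsqr /gmul /gsub; field.
Qed.

(** The two sides of the momentum equation with the convecting cell velocity U,
    the vertex mass flux W, the divergence div and the force f left free, so
    that they also describe the second component after exchange of the axes. *)
Definition momentum_lhs (dt : R) (rh rh' U : cellfun R) (W : vertfun R)
    (u u' : ewfun R) : ewfun R := fun i j =>
  Ax rh i j * ((u' i j - u i j) / dt)
  + Ax (rh \** U \** dx G u') i j + fAy (W \** cDy G u') i j
  + (Ax rh' i j - Ax rh i j) / (2 * dt) * u' i j
  + 1 / 2 * (Dx G (rh \** U) i j + fDy G W i j) * u' i j.

Definition momentum_rhs (M Re : R) (rh mu c mb p div : cellfun R)
    (f u' : ewfun R) : ewfun R := fun i j =>
  - (1 / M * Dx G p i j) + 1 / M * stx rh mb i j * Dx G c i j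
  + 1 / Re * (Dx G (mu \** dx G u') i j + fDy G (Avert mu \** cDy G u') i j)
  + 1 / (3 * Re) * Dx G (mu \** div) i j + f i j.

Lemma momentum_balance (dt M Re : R) (rh rh' mu c mb p div U : cellfun R)
    (W : vertfun R) (f u u' : ewfun R) :
  dt != 0 -> wall u -> wall u' ->
  (forall i, (0 < i < m1)%N -> W i m2 = 0 /\ W i 0%N = 0) ->
  (forall i, (0 < i <= m1)%N -> mu i 0%N = mu i 1%N /\ mu i m2.+1 = mu i m2) ->
  (forall i j, (0 < i < m1)%N -> (0 < j <= m2)%N ->
     momentum_lhs dt rh rh' U W u u' i j
     = momentum_rhs M Re rh mu c mb p div f u' i j) ->
  (2 * dt)^-1 * (cellsum (rh' \** ax (gsqr u')) - cellsum (rh \** ax (gsqr u))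
      + cellsum (rh \** ax (gsqr (gsub u' u))))
  = M^-1 * (cellsum (p \** dx G u') + cellsum (mb \** advx G rh c u'))
    - Re^-1 * (cellsum (mu \** gsqr (dx G u'))
               + cellsum (mu \** vbar (gsqr (cDy G u'))))
    - (3 * Re)^-1 * cellsum (mu \** div \** dx G u')
    + cellsum (f \** u').
Proof.
move=> dt0 ub ub' Wb mub eqn.
have nf := wall_no_flux ub'.
have : cellsum (momentum_lhs dt rh rh' U W u u' \** u')
       = cellsum (momentum_rhs M Re rh mu c mb p div f u' \** u').
  (* The last column is not an interior edge, but u' vanishes there. *)
  apply: cellsum_eq => i j; rewrite /gmul leq_eqVlt => /predU1P[i1|i1] jm.
    by rewrite i1; have [-> _] := nf j jm; rewrite !mulr0.
  by rewrite eqn.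
have -> : cellsum (momentum_lhs dt rh rh' U W u u' \** u')
    = (2 * dt)^-1 * (cellsum (rh' \** ax (gsqr u'))
      - cellsum (rh \** ax (gsqr u)) + cellsum (rh \** ax (gsqr (gsub u' u)))).
  rewrite -sum_kinetic // -[RHS]addr0 -(sum_convection (rh \** U) ub' Wb).
  rewrite -cellsumD; apply: cellsum_eq => i j _ _.
  by rewrite /gadd /gmul /momentum_lhs; ring.
move=> ->.
have -> : cellsum (momentum_rhs M Re rh mu c mb p div f u' \** u')
    = M^-1 * (- cellsum (Dx G p \** u') + cellsum (stx rh mb \** Dx G c \** u'))
      + Re^-1 * (cellsum (Dx G (mu \** dx G u') \** u')
                 + cellsum (fDy G (Avert mu \** cDy G u') \** u'))
      + (3 * Re)^-1 * cellsum (Dx G (mu \** div) \** u') + cellsum (f \** u').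
  rewrite -mulN1r -!cellsumZ -!cellsumD -!cellsumZ -!cellsumD.
  apply: cellsum_eq => i j _ _.
  by rewrite /gadd /gmul /momentum_rhs !div1r; ring.
rewrite !sum_by_parts // sum_surface_tension // sum_shear //.
have -> : cellsum (mu \** gsqr (dx G u')) = cellsum (mu \** dx G u' \** dx G u').
  by apply: cellsum_eq => i j _ _; rewrite /gsqr /gmul mulrA.
ring.
Qed.

End Momentum.

(** * Balance laws of one step of the scheme *)

Section DiscreteLaws.
Context (R : realType) (P : params R) (G : grid R).
Local Notation h := (gh G).
Local Notation m1 := (gm1 G).
Local Notation m2 := (gm2 G).
Local Notation cellsum := (cellsum G).
Context (hP : params_pos P) (hG : grid_ok G).

Let h0 : h != 0. Proof. by case: hG => /lt0r_neq0. Qed.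

(** 1 / rho is affine in c with slope alpha. *)
Lemma rho_jump (a b : R) :
  0 < (prho2 P - prho1 P) * a + prho1 P ->
  0 < (prho2 P - prho1 P) * b + prho1 P ->
  rho P a - rho P b = rfun P a b * (a - b).
Proof.
case: hP => _ _ [/lt0r_neq0 r1 /lt0r_neq0 r2 _ _] /lt0r_neq0 a0 /lt0r_neq0 b0.
by rewrite /rfun /rho /alpha; field; rewrite r1 r2 a0 b0.
Qed.

Lemma Fdw_jump (a b : R) : Fdw a - Fdw b = gfun a b * (a - b).
Proof. by rewrite /Fdw /gfun; field. Qed.

Lemma green (w phi psi : cellfun R) : neumann G phi ->
  cellsum (psi \** divgrad G w phi)
  = - (cellsum (w \** ax (Dx G phi \** Dx G psi))
       + cellsum (w \** ay (Dy G phi \** Dy G psi))).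
Proof.
move=> bphi.
have bphi' : neumann (flip_grid G) (flip phi) by case: bphi.
have fx := green_x h0 w psi (neumann_no_flux bphi).
have fy := @green_x _ (flip_grid G) h0 (flip w) (flip phi) (flip psi)
  (neumann_no_flux bphi').
have -> : cellsum (w \** ay (Dy G phi \** Dy G psi)) =
    ip (flip_grid G) (flip w) (ax (Dx G (flip phi) \** Dx G (flip psi))).
  by rewrite -cellsum_flip.
rewrite ipE opprD -fx -fy -(cellsum_flip (flip_grid G)) -cellsumD.
by apply: cellsum_eq => i j _ _; rewrite /gmul /gadd -mulrDr.
Qed.

Context (s s' : state R).
Context (adm : admissible P G s) (adm' : admissible P G s').
Context (step : scheme_step P G s s').
Context (bc : boundary_conditions P G s) (bc' : boundary_conditions P G s').

Lemma wall_su t : boundary_conditions P G t -> wall G (su t).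
Proof.
by case: hG => _ /andP[_ m2p] _ _ _ [_ _ [ux uy _ _]]; apply: no_slip_wall.
Qed.

Lemma wall_sv t :
  boundary_conditions P G t -> wall (flip_grid G) (flip (sv t)).
Proof.
by case: hG => _ /andP[m1p _] _ _ _ [_ _ [_ _ vy vx]]; apply: no_slip_wall.
Qed.

Local Notation rh := (srho P s).
Local Notation rh' := (srho P s').
Local Notation mu := (svisc P s).
Local Notation u := (su s).
Local Notation v := (sv s).
Local Notation u' := (su s').
Local Notation v' := (sv s').
Local Notation Q := (Qflux P G s s').
Local Notation c := (sc s).
Local Notation c' := (sc s').
Local Notation M := (pM P).
Local Notation Re := (pRe P).
Local Notation We := (pWe P).
Local Notation Fr := (pFr P).
Local Notation Pe := (pPe P).
Local Notation eta := (peta P).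
Local Notation eps := (peps P).
Local Notation dt := (pdt P).

(** Multiply the phase equation by - alpha rho^n.  By [rho_jump] the increments
    of c in time and in space become increments of rho, since each advection
    term carries the density of the opposite cell, and Q becomes the velocity
    divergence; the discrete product rule does the rest. *)
Lemma mass_conservation i j : (i < m1)%N -> (j < m2)%N ->
  (rh' i.+1 j.+1 - rh i.+1 j.+1) / dt
  = - ddiv G (Ax rh \** u') (Ay rh \** v') i.+1 j.+1.
Proof.
move=> im jm; case: step => _ _ eqd eqc _.
have im1 : (i.+1 <= m1.+1)%N by exact: ltnW.
have jm1 : (j.+1 <= m2.+1)%N by exact: ltnW.
have [ad1 _] := adm im1 jm1.
have jump k l : (k <= m1.+1)%N -> (l <= m2.+1)%N ->
  rh k l - rh i.+1 j.+1 = rfun P (c k l) (c i.+1 j.+1) * (c k l - c i.+1 j.+1).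
  by move=> km lm; apply: rho_jump => //; have [] := adm km lm.
have jump' : rh' i.+1 j.+1 - rh i.+1 j.+1
    = rfun P (c' i.+1 j.+1) (c i.+1 j.+1) * (c' i.+1 j.+1 - c i.+1 j.+1).
  by apply: rho_jump => //; have [] := adm' im1 jm1.
have := eqd i.+1 j.+1 im jm; have := eqc i.+1 j.+1 im jm.
rewrite /eq_quasi_incompressible /eq_phase => <-.
have e1 := jump i.+2 j.+1 im jm1.
have e2 := jump i j.+1 (ltnW im1) jm1.
have e3 := jump i.+1 j.+2 im1 jm.
have e4 := jump i.+1 j im1 (ltnW jm1).
have rE k l : rho P (c k l) = rh k l by [].
have rE' k l : rho P (c' k l) = rh' k l by [].
move: e1 e2 e3 e4 jump'; rewrite /rfun !rE !rE' => e1 e2 e3 e4 e0 ediv.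
rewrite e0.
have -> : ddiv G (Ax rh \** u') (Ay rh \** v') i.+1 j.+1
  = rh i.+1 j.+1 * (dx G u' i.+1 j.+1 + dy G v' i.+1 j.+1)
    + ((rh i.+2 j.+1 - rh i.+1 j.+1) * u' i.+1 j.+1
       - (rh i j.+1 - rh i.+1 j.+1) * u' i j.+1
       + (rh i.+1 j.+2 - rh i.+1 j.+1) * v' i.+1 j.+1
       - (rh i.+1 j - rh i.+1 j.+1) * v' i.+1 j) / (2 * h).
  by rewrite /ddiv /gadd /gmul /Ax /Ay /dx /dy /=; field.
rewrite ediv e1 e2 e3 e4 /advx /advy /Dx /Dy /=.
by field; case: hP => _ [_ _ _ /lt0r_neq0 ->]; rewrite h0.
Qed.

(** Conservation of mass tested with y, whose difference quotient is 1. *)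
Lemma gravity_work :
  cellsum (Ay rh \** v')
  = dt^-1 * (cellsum (rh' \** ycell G) - cellsum (rh \** ycell G)).
Proof.
rewrite -mulN1r -!cellsumZ -cellsumD -cellsumZ.
have nf := wall_no_flux (wall_sv bc').
have nfx := wall_no_flux (wall_su bc').
apply: (cellsum_divergence
  (T1 := fun i j => ycell G i j * Ax rh i j / h * u' i j)
  (T2 := fun i j => ycell G i j.+1 * Ay rh i j / h * v' i j)).
- by move=> j jm; have [-> ->] := nfx j jm; rewrite !mulr0.
- by move=> i im; have [/= e e'] := nf i im; move: e e'; rewrite /flip => -> ->;
    rewrite !mulr0.
- move=> i j im jm.
  have := mass_conservation im jm; rewrite /gadd /gmul => e.
  have -> : dt^-1 * (rh' i.+1 j.+1 * ycell G i.+1 j.+1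
     + -1 * (rh i.+1 j.+1 * ycell G i.+1 j.+1)) =
     (rh' i.+1 j.+1 - rh i.+1 j.+1) / dt * ycell G i.+1 j.+1 by ring.
  rewrite e /ddiv /gadd /gmul /dx /dy /ycell /=.
  by rewrite -(natr1 j.+1) -(natr1 j); field.
Qed.

(** Q is the divergence of m grad mu_c, as mu_c is mu_c-bar plus alpha times
    p-bar. *)
Lemma mobility_dissipation :
  h ^+ 2 * cellsum (Q \** smu P s') = - (1 / Pe * nrm2_grad G (smob P s) (smu P s')).
Proof.
have Pe0 : Pe != 0 by case: hP => _ [/lt0r_neq0].
case: bc' => _ bmu _.
have -> : cellsum (Q \** smu P s')
    = cellsum (fun i j => Pe^-1 * (smu P s' \** divgrad G (smob P s) (smu P s')) i j).
  apply: cellsum_eq => i j _ _.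
  rewrite /gmul /Qflux /divgrad /smu /ddiv /gadd /gmul /dx /dy /Dx /Dy.
  by field; rewrite h0.
by rewrite cellsumZ green // /nrm2_grad /ip /gsqr -!/(cellsum _); field.
Qed.

(** In every product the change is the average of one factor times the jump of
    the other plus the symmetric term.  For rho F these are the terms with g and
    r; for rho |grad c|^2 they are the term with r and, through Green's formula
    for c^(n+1/2) against c^(n+1) - c^n, the term with the divergence. *)
Lemma free_energy_jump :
  h ^+ 2 / M * cellsum (smub s' \** (rh' \** gsub c' c))
  = eps * eta / (2 * We) * (nrm2_grad G rh' c' - nrm2_grad G rh c)
    + eta * h ^+ 2 / (eps * We)
      * (ip G (rh' \** sF s') (fun _ _ => 1) - ip G (rh \** sF s) (fun _ _ => 1)).
Proof.
case: hP => [[/lt0r_neq0 M0 _ /lt0r_neq0 We0 _] [_ _ /lt0r_neq0 eps0 _] _].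
case: bc => bcc _ _; case: bc' => bcc' _ _; case: step => _ _ _ _ eqp.
have bh : neumann G (gavg c' c).
  case: bcc bcc' => [x y] [x' y']; split=> k km; rewrite /gavg.
    by have [-> ->] := x k km; have [-> ->] := x' k km.
  by have [-> ->] := y k km; have [-> ->] := y' k km.
have gr := green (gavg rh' rh) (gsub c' c) bh.
have -> : cellsum (smub s' \** (rh' \** gsub c' c)) =
    M * eta / (eps * We) * (cellsum (rh' \** sF s') - cellsum (rh \** sF s))
    + eps * eta * M / (2 * We)
       * cellsum (gavg (grad2 G c') (grad2 G c) \** gsub rh' rh)
    - eps * eta * M / We * cellsum (gsub c' c \** divgrad G (gavg rh' rh) (gavg c' c)).
  rewrite -[- cellsum (rh \** _)]mulN1r -mulNr -!cellsumZ -cellsumD.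
  rewrite -!cellsumZ -!cellsumD.
  apply: cellsum_eq => i j im jm; rewrite /gadd.
  have := eqp i.+1 j.+1 im jm; rewrite /eq_chemical_potential /gmul => e.
  have -> : smub s' i.+1 j.+1 * (rh' i.+1 j.+1 * gsub c' c i.+1 j.+1)
    = rh' i.+1 j.+1 * smub s' i.+1 j.+1 * gsub c' c i.+1 j.+1 by ring.
  rewrite e {e}.
  have eF := Fdw_jump (c' i.+1 j.+1) (c i.+1 j.+1).
  have er : rh' i.+1 j.+1 - rh i.+1 j.+1
    = rfun P (c' i.+1 j.+1) (c i.+1 j.+1) * (c' i.+1 j.+1 - c i.+1 j.+1).
    by apply: rho_jump; [have [] := @adm' i.+1 j.+1 (ltnW im) (ltnW jm)
                        |have [] := @adm i.+1 j.+1 (ltnW im) (ltnW jm)].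
  have eF' : sF s' i.+1 j.+1 = sF s i.+1 j.+1
    + gfun (c' i.+1 j.+1) (c i.+1 j.+1) * (c' i.+1 j.+1 - c i.+1 j.+1).
    by rewrite -eF /sF /gmap; ring.
  rewrite /gsub /gavg eF'; move/(canRL (subrK _)): er => ->.
  by field; rewrite We0 eps0.
have -> : cellsum (gavg (grad2 G c') (grad2 G c) \** gsub rh' rh)
    = cellsum (rh' \** ax (gsqr (Dx G c'))) + cellsum (rh' \** ay (gsqr (Dy G c')))
      - (cellsum (rh \** ax (gsqr (Dx G c))) + cellsum (rh \** ay (gsqr (Dy G c))))
      - 2 * (cellsum (gavg rh' rh \** ax (Dx G (gavg c' c) \** Dx G (gsub c' c)))
           + cellsum (gavg rh' rh \** ay (Dy G (gavg c' c) \** Dy G (gsub c' c)))).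
  rewrite -mulN1r -mulNr -!cellsumD -!cellsumZ -!cellsumD.
  apply: cellsum_eq => i j _ _.
  rewrite /gadd /gmul /gavg /gsub /grad2 /gsqr /gadd /gmul /ax /ay /Dx /Dy.
  by field.
have ip1 (f : cellfun R) : ip G f (fun _ _ => 1) = cellsum f.
  by apply: cellsum_eq => i j _ _; rewrite mulr1.
rewrite gr /nrm2_grad !ip1 !ipE.
by field; rewrite M0 We0 eps0.
Qed.

Lemma momentum_x_balance :
  (2 * dt)^-1 * (cellsum (rh' \** ax (gsqr u')) - cellsum (rh \** ax (gsqr u))
      + cellsum (rh \** ax (gsqr (gsub u' u))))
  = M^-1 * (cellsum (spb s' \** dx G u') + cellsum (smub s' \** advx G rh c u'))
    - Re^-1 * (cellsum (mu \** gsqr (dx G u'))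
               + cellsum (mu \** vbar (gsqr (cDy G u'))))
    - (3 * Re)^-1 * cellsum (mu \** ddiv G u' v' \** dx G u').
Proof.
have dt0 : dt != 0 by case: hP => _ [_ _ _ /lt0r_neq0].
case: step => eqx _ _ _ _; case: (bc) => [[_ cy] _ [_ _ vy _]].
have f0 : cellsum ((fun _ _ => 0) \** u') = 0.
  rewrite -[RHS](mul0r (cellsum u')) -cellsumZ.
  by apply: cellsum_eq => i j _ _; rewrite /gmul !mul0r.
rewrite -[RHS]addr0 -[X in _ = _ + X]f0.
apply: (momentum_balance h0 (U := ax u) (W := Avert rh \** cAx v)) => //.
- exact: wall_su.
- exact: wall_su.
- move=> i /andP[i0 im]; rewrite /gmul /cAx.
  have [|-> ->] := vy i; first by rewrite i0 ltnW.
  by have [|-> ->] := vy i.+1; rewrite ?addr0 ?mul0r ?mulr0.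
- by move=> i im; rewrite /svisc /gmap; have [-> ->] := cy i im.
- move=> i j im jm; rewrite /momentum_rhs addr0.
  exact: (eqx i j im jm).
Qed.

Lemma momentum_y_balance :
  (2 * dt)^-1 * (cellsum (rh' \** ay (gsqr v')) - cellsum (rh \** ay (gsqr v))
      + cellsum (rh \** ay (gsqr (gsub v' v))))
  = M^-1 * (cellsum (spb s' \** dy G v') + cellsum (smub s' \** advy G rh c v'))
    - Re^-1 * (cellsum (mu \** gsqr (dy G v'))
               + cellsum (mu \** vbar (gsqr (cDx G v'))))
    - (3 * Re)^-1 * cellsum (mu \** ddiv G u' v' \** dy G v')
    - Fr^-1 * cellsum (Ay rh \** v').
Proof.
have dt0 : dt != 0 by case: hP => _ [_ _ _ /lt0r_neq0].
case: step => _ eqy _ _ _; case: (bc) => [[cx _] _ [ux _ _ _]].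
have bal := @momentum_balance _ (flip_grid G) h0 dt M Re (flip rh) (flip rh')
  (flip mu) (flip c) (flip (smub s')) (flip (spb s')) (flip (ddiv G u' v'))
  (flip (ay v)) (flip (Avert rh \** cAy u))
  (flip (fun i j => - Fr^-1 * Ay rh i j)) (flip v) (flip v')
  dt0 (wall_sv bc) (wall_sv bc').
have vbarE : cellsum (mu \** vbar (gsqr (cDx G v')))
    = ip (flip_grid G) (flip mu) (vbar (gsqr (cDy (flip_grid G) (flip v')))).
  rewrite ipE -(cellsum_flip (flip_grid G)); apply: cellsum_eq => i j _ _.
  by rewrite /gmul /flip /vbar /gsqr /gmul /cDx /cDy /=; ring.
have forceE : - (Fr^-1 * cellsum (Ay rh \** v'))
    = cellsum ((fun i j => - Fr^-1 * Ay rh i j) \** v').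
  by rewrite -mulNr -cellsumZ; apply: cellsum_eq => i j _ _; rewrite /gmul mulrA.
rewrite vbarE forceE -!(cellsum_flip G); apply: bal.
- move=> i /andP[i0 im]; rewrite /flip /gmul /cAy.
  have [|-> ->] := ux i; first by rewrite i0 ltnW.
  by have [|-> ->] := ux i.+1; rewrite ?addr0 ?mul0r ?mulr0.
- by move=> i im; rewrite /flip /svisc /gmap; have [-> ->] := cx i im.
- move=> j i jm im; have := eqy i j im jm.
  rewrite /eq_momentum_y => /eqP; rewrite -subr_eq0 => /eqP e.
  apply/eqP; rewrite -subr_eq0 -e; apply/eqP.
  rewrite /momentum_lhs /momentum_rhs /flip /gmul /Ax /Ay /fAx /fAy /Dx /Dy
    /cDx /cDy /fDx /fDy /stx /sty /Avert /dx /dy /=.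
  by rewrite !div1r; ring.
Qed.

(** The pressure is the multiplier of the constraint div u = alpha Q. *)
Lemma pressure_work :
  cellsum (spb s' \** dx G u') + cellsum (spb s' \** dy G v')
  = cellsum (Q \** (fun i j => alpha P * spb s' i j)).
Proof.
case: step => _ _ eqd _ _; rewrite -cellsumD; apply: cellsum_eq => i j im jm.
have := eqd i.+1 j.+1 im jm; rewrite /eq_quasi_incompressible => e.
by rewrite /gadd /gmul -mulrDr e; ring.
Qed.

Lemma surface_tension_work :
  cellsum (smub s' \** advx G rh c u') + cellsum (smub s' \** advy G rh c v')
  = cellsum (Q \** smub s') - dt^-1 * cellsum (smub s' \** (rh' \** gsub c' c)).
Proof.
case: step => _ _ _ eqc _; rewrite -mulNr -cellsumZ -!cellsumD.
apply: cellsum_eq => i j im jm.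
have := eqc i.+1 j.+1 im jm; rewrite /eq_phase => e.
by rewrite /gadd /gmul -e /gsub; ring.
Qed.

Lemma energy_law :
  energy P G s' - energy P G s
  = - (dt / Re * nrm2_gradvel G mu u' v') - dt / (3 * Re) * nrm2_div G mu u' v'
    - dt / (M * Pe) * nrm2_grad G (smob P s) (smu P s')
    - 1 / 2 * nrm2_vel G rh (gsub u' u) (gsub v' v).
Proof.
case: hP => [[/lt0r_neq0 M0 /lt0r_neq0 Re0 /lt0r_neq0 We0 /lt0r_neq0 Fr0]].
case=> [/lt0r_neq0 Pe0 _ /lt0r_neq0 eps0 /lt0r_neq0 dt0] _.
have mx := momentum_x_balance; have my := momentum_y_balance.
have pw := pressure_work; have st := surface_tension_work.
have gw := gravity_work; have md := mobility_dissipation.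
have fe := free_energy_jump.
have ip1 (f : cellfun R) : ip G f (fun _ _ => 1) = cellsum f.
  by apply: cellsum_eq => i j _ _; rewrite mulr1.
have muE : cellsum (Q \** smu P s') =
    cellsum (Q \** smub s') + cellsum (Q \** (fun i j => alpha P * spb s' i j)).
  by rewrite -cellsumD; apply: cellsum_eq => i j _ _; rewrite /gadd /gmul -mulrDr.
have divE : cellsum (mu \** gsqr (ddiv G u' v')) =
   cellsum (mu \** ddiv G u' v' \** dx G u')
   + cellsum (mu \** ddiv G u' v' \** dy G v').
  rewrite -cellsumD; apply: cellsum_eq => i j _ _.
  by rewrite /gsqr /gadd /gmul /ddiv /gadd -mulrDr mulrA.
rewrite muE -pw in md.
rewrite /energy /nrm2_vel /nrm2_gradvel /nrm2_div !ip1 !ipE divE.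
rewrite !ip1 in fe.
(* The multiple of st removes the work of surface tension from the momentum
   balances, those of md and fe then replace the products of Q and of the phase
   increment, and that of gw replaces the work of gravity. *)
apply: (eq_by_combination (k := h ^+ 2 * dt) mx).
apply: (eq_by_combination (k := h ^+ 2 * dt) my).
apply: (eq_by_combination (k := h ^+ 2 * dt / M) st).
apply: (eq_by_combination (k := dt / M) md).
apply: (eq_by_combination (k := -1) fe).
apply: (eq_by_combination (k := - (h ^+ 2 * dt / Fr)) gw).
by field; rewrite M0 Re0 We0 Fr0 Pe0 eps0 dt0.
Qed.

(** * Sign of the dissipation *)

Lemma gsqr_ge0 (f : cellfun R) i j : 0 <= gsqr f i j.
Proof. exact: sqr_ge0. Qed.

Lemma rho_visc_gt0 t i j : admissible P G t -> (i < m1)%N -> (j < m2)%N ->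
  0 < srho P t i.+1 j.+1 /\ 0 < svisc P t i.+1 j.+1.
Proof.
move=> admt im jm; case: hP => _ _ [r1 r2 n1 n2].
have [a b] := admt i.+1 j.+1 (ltnW im) (ltnW jm).
by rewrite /srho /svisc /gmap /rho /visc !divr_gt0 ?mulr_gt0.
Qed.

Lemma ip_ge0 (f g : cellfun R) :
  (forall i j, (i < m1)%N -> (j < m2)%N -> 0 <= f i.+1 j.+1) ->
  (forall i j, 0 <= g i j) -> 0 <= h ^+ 2 * ip G f g.
Proof.
move=> f0 g0; rewrite mulr_ge0 ?sqr_ge0 // ipE; apply: cellsum_ge0 => i j im jm.
by rewrite mulr_ge0 // f0.
Qed.

Lemma energy_dissipation :
  - (dt / Re * nrm2_gradvel G mu u' v') - dt / (3 * Re) * nrm2_div G mu u' v'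
    - dt / (M * Pe) * nrm2_grad G (smob P s) (smu P s')
    - 1 / 2 * nrm2_vel G rh (gsub u' u) (gsub v' v) <= 0.
Proof.
case: hP => [[/ltW M0 /ltW Re0 _ _] [/ltW Pe0 _ _ /ltW dt0] _].
have rh0 i j : (i < m1)%N -> (j < m2)%N -> 0 <= rh i.+1 j.+1.
  by move=> im jm; have [/ltW] := rho_visc_gt0 adm im jm.
have mu0 i j : (i < m1)%N -> (j < m2)%N -> 0 <= mu i.+1 j.+1.
  by move=> im jm; have [_ /ltW] := rho_visc_gt0 adm im jm.
have mob0 i j : (i < m1)%N -> (j < m2)%N -> 0 <= smob P s i.+1 j.+1.
  by move=> _ _; exact: sqrtr_ge0.
have ax0 f i j : 0 <= ax (gsqr f) i j :> R.
  by rewrite /ax mulr_ge0 ?addr_ge0 ?gsqr_ge0 ?invr_ge0.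
have ay0 f i j : 0 <= ay (gsqr f) i j :> R.
  by rewrite /ay mulr_ge0 ?addr_ge0 ?gsqr_ge0 ?invr_ge0.
have vb0 f i j : 0 <= vbar (gsqr f) i j :> R.
  by rewrite /vbar mulr_ge0 ?addr_ge0 ?gsqr_ge0 ?invr_ge0.
have gv0 : 0 <= nrm2_gradvel G mu u' v'.
  by rewrite !addr_ge0 ?ip_ge0 // => i j; exact: gsqr_ge0.
have dv0 : 0 <= nrm2_div G mu u' v' by apply: ip_ge0 => // i j; exact: gsqr_ge0.
have gm0 : 0 <= nrm2_grad G (smob P s) (smu P s') by rewrite addr_ge0 ?ip_ge0.
have vl0 : 0 <= nrm2_vel G rh (gsub u' u) (gsub v' v) by rewrite addr_ge0 ?ip_ge0.
rewrite -!opprD oppr_le0.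
by rewrite !addr_ge0 //; apply: mulr_ge0 => //; apply: divr_ge0 => //; apply: mulr_ge0.
Qed.

End DiscreteLaws.

Theorem theorem6p2 (R : realType) (P : params R) (G : grid R)
    (S : nat -> state R)
    (hP : params_pos P) (hG : grid_ok G)
    (hadm : forall n : nat, admissible P G (S n))
    (hscheme : forall n : nat, scheme_step P G (S n) (S n.+1))
    (hbc : forall n : nat, boundary_conditions P G (S n)) :
  forall n : nat,
    energy P G (S n.+1) - energy P G (S n)
      = - (pdt P / pRe P
             * nrm2_gradvel G (svisc P (S n)) (su (S n.+1)) (sv (S n.+1)))
        - pdt P / (3 * pRe P)
             * nrm2_div G (svisc P (S n)) (su (S n.+1)) (sv (S n.+1))
        - pdt P / (pM P * pPe P)
             * nrm2_grad G (smob P (S n)) (smu P (S n.+1))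
        - 1 / 2 * nrm2_vel G (srho P (S n))
                    (gsub (su (S n.+1)) (su (S n)))
                    (gsub (sv (S n.+1)) (sv (S n)))
    /\ - (pdt P / pRe P
             * nrm2_gradvel G (svisc P (S n)) (su (S n.+1)) (sv (S n.+1)))
        - pdt P / (3 * pRe P)
             * nrm2_div G (svisc P (S n)) (su (S n.+1)) (sv (S n.+1))
        - pdt P / (pM P * pPe P)
             * nrm2_grad G (smob P (S n)) (smu P (S n.+1))
        - 1 / 2 * nrm2_vel G (srho P (S n))
                    (gsub (su (S n.+1)) (su (S n)))
                    (gsub (sv (S n.+1)) (sv (S n)))
       <= 0.
Proof.
move=> n; split.
  exact: (energy_law hP hG (hadm n) (hadm n.+1) (hscheme n) (hbc n) (hbc n.+1)).
exact: energy_dissipation.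
Qed.
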